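(* Let $\nu>0$, let $U_e:(0,\infty)\to[0,\infty)$ be a differentiable function, and let $\alpha,\beta\in\mathbb{R}$ with $\alpha+\beta=1$. Assume that the equation $$\partial_y\psi\,\partial^2_{xy}\psi-\partial_x\psi\,\partial^2_{yy}\psi = U_e\,\partial_xU_e+\nu\,\partial^3_{yyy}\psi ,\qquad x>0,\ y>0,$$ has a similarity solution of the form $\psi(x,y)=x^{\alpha}f(yx^{-\beta})$. Then there exist two nonnegative constants $c_1,c_2$ such that $$U_e^2(x)=c_1x^{2m}+c_2\qquad\text{for all }x>0,$$ where $m=\alpha-\beta$.
   Context: The equation is the stream-function form of the two-dimensional steady laminar boundary layer (Prandtl) equations; $U_e=U_e(x)$ is a given external velocity, assumed nonnegative, depending only on $x$, and $\nu>0$ is the kinematic viscosity. A similarity solution of the form $\psi(x,y)=x^\alpha f(yx^{-\beta})$ means a function of this form, where $f$ is a real function of one variable $t>0$ (smooth enough, e.g. three times differentiable, for the equation to make sense), which satisfies the equation for all $x>0$, $y>0$. *)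

(* Defs.v *)
From Stdlib Require Import Reals.
From Coquelicot Require Import Coquelicot.
Open Scope R_scope.

(* [partial_derive m k psi x y] differentiates k times in y, then m times in x.
   [Derive] is total, so this predicate makes sense only for psi with enough
   partial derivatives on the open quadrant. *)
Definition boundary_layer_solution (nu : R) (Ue : R -> R) (psi : R -> R -> R)
  : Prop :=
  forall x y : R, 0 < x -> 0 < y ->
    partial_derive 0 1 psi x y * partial_derive 1 1 psi x y
    - partial_derive 1 0 psi x y * partial_derive 0 2 psi x y
    = Ue x * Derive Ue x + nu * partial_derive 0 3 psi x y.

(* [ex_derive_n f k t] only asserts existence of the last derivative, hence the
   quantification over all orders k <= n. *)
Definition times_differentiable_pos (n : nat) (f : R -> R) : Prop :=
  forall (k : nat) (t : R), (k <= n)%nat -> 0 < t -> ex_derive_n f k t.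

(* psi and f are total functions, but only their values on x, y > 0 and t > 0
   matter. Three derivatives of f guarantee the existence of all the partial
   derivatives of psi occurring in the equation. *)
Definition has_similarity_solution (nu : R) (Ue : R -> R) (alpha beta : R)
  : Prop :=
  exists (psi : R -> R -> R) (f : R -> R),
    times_differentiable_pos 3 f /\
    (forall x y : R, 0 < x -> 0 < y ->
       psi x y = Rpower x alpha * f (y * Rpower x (- beta))) /\
    boundary_layer_solution nu Ue psi.

(* Main.v *)
Require Import Defs.
From Stdlib Require Import Reals Lra Lia.
From Coquelicot Require Import Coquelicot.
Open Scope R_scope.

(** Inserting [psi] into the equation, every term carries the same power of [x],
    because [alpha + beta = 1] makes [2 m - 1 = alpha - 3 beta]. Along the curve
    [y = x^beta] the similarity variable is [1], so [Ue Ue' = C x^(2 m - 1)] with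
    [C = m f'(1)^2 - alpha f(1) f''(1) - nu f'''(1)]. Integrating,
    [Ue^2] is [(C / m) x^(2 m) + c2] if [m <> 0] and [2 C ln x + c2] if [m = 0].
    As [x^(2 m)] and [ln x] sweep [(0, oo)] and the whole line, nonnegativity of
    [Ue^2] forces both constants to be nonnegative, and [C = 0] when [m = 0]. *)

Lemma is_derive_Rpower (p x : R) :
  0 < x -> is_derive (fun z => Rpower z p) x (p * Rpower x (p - 1)).
Proof.
  intros Hx. apply is_derive_Reals. now apply derivable_pt_lim_power.
Qed.

(** The difference has zero derivative on the half-line, hence is constant there; its value is read
    off at 1. *)
Lemma same_derivative_pos (g h d : R -> R) :
  (forall x, 0 < x -> is_derive g x (d x)) ->
  (forall x, 0 < x -> is_derive h x (d x)) ->
  forall x, 0 < x -> g x = h x + (g 1 - h 1).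
Proof.
  intros Hg Hh.
  assert (H0 : forall x, 0 < x -> is_derive (fun z => g z - h z) x zero).
  { intros x Hx. replace (@zero R_NormedModule) with (minus (d x) (d x)).
    - now apply (is_derive_minus g h); [apply Hg | apply Hh].
    - apply (@minus_eq_zero R_AbelianGroup). }
  intros x Hx.
  destruct (Rtotal_order x 1) as [Hlt | [-> | Hgt]].
  - generalize (eq_is_derive _ x 1 (fun t Ht => H0 t ltac:(lra)) Hlt). simpl. lra.
  - lra.
  - generalize (eq_is_derive _ 1 x (fun t Ht => H0 t ltac:(lra)) Hgt). simpl. lra.
Qed.

Lemma nonneg_affine_coefs (a b : R) :
  (forall u, 0 < u -> 0 <= a * u + b) -> 0 <= a /\ 0 <= b.
Proof.
  intros H. split; apply Rnot_lt_le; intros Hlt.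
  (* For [a < 0], this [u] gives [a * u + b = b - Rabs b - 1 <= -1]. *)
  - assert (Hu : 0 < (Rabs b + 1) / - a).
    { apply Rdiv_lt_0_compat; [generalize (Rabs_pos b) |]; lra. }
    specialize (H _ Hu).
    replace (a * ((Rabs b + 1) / - a)) with (- (Rabs b + 1)) in H by (field; lra).
    generalize (Rle_abs b). lra.
  - generalize (Rabs_pos a) (Rle_abs a). intros Ha Ha'.
    (* For [b < 0], this [u] is small enough: [a * u + b <= Rabs a * u + b = - u < 0]. *)
    assert (Hu : 0 < - b / (Rabs a + 1)) by (apply Rdiv_lt_0_compat; lra).
    specialize (H _ Hu).
    assert (Hv : (Rabs a + 1) * (- b / (Rabs a + 1)) = - b) by (field; lra).
    nra.
Qed.

Lemma nonneg_Rpower_coefs (p a b : R) :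
  p <> 0 -> (forall x, 0 < x -> 0 <= a * Rpower x p + b) -> 0 <= a /\ 0 <= b.
Proof.
  intros Hp H. apply nonneg_affine_coefs. intros u Hu.
  (* The point is the [p]-th root of [u], which turns the power of [x] into [u] itself. *)
  specialize (H (exp (ln u / p)) (exp_pos _)). unfold Rpower in H.
  rewrite ln_exp in H. replace (p * (ln u / p)) with (ln u) in H by now field.
  now rewrite exp_ln in H.
Qed.

Lemma nonneg_ln_coef (a b : R) :
  (forall x, 0 < x -> 0 <= a * ln x + b) -> a = 0.
Proof.
  intros H. destruct (Req_dec a 0) as [| Ha]; [assumption | exfalso].
  (* At this point the affine function of [ln x] takes the value -1. *)
  specialize (H (exp (- (b + 1) / a)) (exp_pos _)). rewrite ln_exp in H.
  replace (a * (- (b + 1) / a)) with (- (b + 1)) in H by now field.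
  lra.
Qed.

Lemma nonneg_power_primitive (g : R -> R) (C m : R) :
  (forall x, 0 < x -> 0 <= g x) ->
  (forall x, 0 < x -> is_derive g x (2 * C * Rpower x (2 * m - 1))) ->
  exists c1 c2 : R, 0 <= c1 /\ 0 <= c2 /\
    forall x, 0 < x -> g x = c1 * Rpower x (2 * m) + c2.
Proof.
  intros Hpos Hg. destruct (Req_dec m 0) as [-> | Hm].
  - assert (Hh : forall x, 0 < x -> g x = 2 * C * ln x + (g 1 - 2 * C * ln 1)).
    { apply (same_derivative_pos g (fun x => 2 * C * ln x) _ Hg). intros x Hx.
      replace (2 * 0 - 1) with (- (1)) by ring.
      rewrite Rpower_Ropp, Rpower_1 by assumption.
      apply is_derive_scal. now apply is_derive_ln. }
    assert (HC : 2 * C = 0).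
    { apply nonneg_ln_coef with (g 1 - 2 * C * ln 1).
      intros x Hx. rewrite <- Hh; auto. }
    (* The logarithm has dropped out, so [g] is constant and all of it goes into [c2]. *)
    exists 0, (g 1). split; [lra | split; [apply Hpos; lra |]].
    intros x Hx. rewrite (Hh x Hx), HC. ring.
  - set (b := g 1 - C / m * Rpower 1 (2 * m)).
    assert (Hh : forall x, 0 < x -> g x = C / m * Rpower x (2 * m) + b).
    { apply (same_derivative_pos g (fun x => C / m * Rpower x (2 * m)) _ Hg).
      intros x Hx.
      replace (2 * C * Rpower x (2 * m - 1))
        with (C / m * (2 * m * Rpower x (2 * m - 1))) by now field.
      apply is_derive_scal. now apply is_derive_Rpower. }
    destruct (nonneg_Rpower_coefs (2 * m) (C / m) b) as [H1 H2]; [lra | |].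
    + intros x Hx. rewrite <- Hh; auto.
    + now exists (C / m), b.
Qed.

(** Both [g] and the exponent [a] are free because each [y]-derivative of [psi] is again of
    similarity form, with a derivative of [f] as profile and a shifted exponent. *)
Lemma is_derive_similarity (g : R -> R) (a beta x y : R) :
  0 < x -> ex_derive g (y * Rpower x (- beta)) ->
  is_derive (fun z => Rpower z a * g (y * Rpower z (- beta))) x
    (Rpower x (a - 1) * (a * g (y * Rpower x (- beta))
       - beta * (y * Rpower x (- beta)) * Derive g (y * Rpower x (- beta)))).
Proof.
  intros Hx Hg.
  assert (Hin : is_derive (fun z => y * Rpower z (- beta)) x
                  (y * (- beta * Rpower x (- beta - 1)))).
  { apply is_derive_scal. now apply is_derive_Rpower. }
  evar_last.
  { exact (is_derive_mult _ _ _ _ _ (is_derive_Rpower a x Hx)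
      (is_derive_comp g _ _ _ _ (Derive_correct _ _ Hg) Hin) Rmult_comm). }
  unfold plus, mult, scal; simpl; unfold mult; simpl.
  unfold Rminus. rewrite !Rpower_plus. ring.
Qed.

Lemma locally_pos (x : R) : 0 < x -> locally x (fun z => 0 < z).
Proof. exact (open_gt 0 x). Qed.

(** For fixed [x] the profile is composed with a dilation, so each differentiation in [y] brings out
    one factor [Rpower x (- beta)]. *)
Lemma partial_derive_similarity_y
  (psi : R -> R -> R) (f : R -> R) (alpha beta : R)
  (f_smooth : times_differentiable_pos 3 f)
  (psi_eq : forall x y : R, 0 < x -> 0 < y ->
     psi x y = Rpower x alpha * f (y * Rpower x (- beta)))
  (k : nat) (x y : R) :
  (k <= 3)%nat -> 0 < x -> 0 < y ->
  partial_derive 0 k psi x y =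
    Rpower x (alpha - INR k * beta) * Derive_n f k (y * Rpower x (- beta)).
Proof.
  intros Hk Hx Hy.
  assert (Hs : 0 < Rpower x (- beta)) by apply exp_pos.
  change (Derive_n (psi x) k y = Rpower x (alpha - INR k * beta)
    * Derive_n f k (y * Rpower x (- beta))).
  rewrite (Derive_n_ext_loc (psi x)
    (fun z => Rpower x alpha * f (Rpower x (- beta) * z))).
  - rewrite Derive_n_scal_l, Derive_n_comp_scal.
    + rewrite <- Rpower_pow, Rpower_mult by assumption.
      unfold Rminus. rewrite Rpower_plus, (Rmult_comm y).
      replace (- beta * INR k) with (- (INR k * beta)) by ring. ring.
    (* The rule for iterated derivatives under a dilation asks for all orders up to [k] near the
       point, not only at it. *)
    + apply filter_imp with (2 := locally_pos _ (Rmult_lt_0_compat _ _ Hs Hy)).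
      intros z Hz j Hj. apply f_smooth; [lia | assumption].
  - apply filter_imp with (2 := locally_pos y Hy).
    intros z Hz. now rewrite psi_eq, Rmult_comm with (r1 := z).
Qed.

Lemma partial_derive_similarity_x
  (psi : R -> R -> R) (f : R -> R) (alpha beta : R)
  (f_smooth : times_differentiable_pos 3 f)
  (psi_eq : forall x y : R, 0 < x -> 0 < y ->
     psi x y = Rpower x alpha * f (y * Rpower x (- beta)))
  (k : nat) (x y : R) :
  (k <= 2)%nat -> 0 < x -> 0 < y ->
  let t := y * Rpower x (- beta) in
  partial_derive 1 k psi x y =
    Rpower x (alpha - INR k * beta - 1) *
      ((alpha - INR k * beta) * Derive_n f k t - beta * t * Derive_n f (S k) t).
Proof.
  intros Hk Hx Hy t.
  assert (Ht : 0 < t) by (apply Rmult_lt_0_compat; [assumption | apply exp_pos]).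
  unfold partial_derive; simpl.
  (* The closed form of the [y]-derivative is known for positive abscissas only, so it is
     substituted on a neighbourhood of [x]. *)
  rewrite (Derive_ext_loc _ (fun z => Rpower z (alpha - INR k * beta)
                                * Derive_n f k (y * Rpower z (- beta)))).
  - apply is_derive_unique, is_derive_similarity; [assumption |].
    apply (f_smooth (S k) t); [lia | assumption].
  - apply filter_imp with (2 := locally_pos x Hx).
    intros z Hz. rewrite <- (partial_derive_similarity_y psi f) by (lia || assumption).
    reflexivity.
Qed.

Theorem theorem2p1 (nu : R) (Ue : R -> R) (alpha beta m : R)
  (Hnu : 0 < nu)
  (HUe_nonneg : forall x : R, 0 < x -> 0 <= Ue x)
  (HUe_diff : forall x : R, 0 < x -> ex_derive Ue x)
  (Hab : alpha + beta = 1)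
  (Hm : m = alpha - beta)
  (Hsol : has_similarity_solution nu Ue alpha beta) :
  exists c1 c2 : R, 0 <= c1 /\ 0 <= c2 /\
    forall x : R, 0 < x -> (Ue x) ^ 2 = c1 * Rpower x (2 * m) + c2.
Proof.
  destruct Hsol as (psi & f & Hf & Hpsi & Heq).
  set (C := m * Derive_n f 1 1 ^ 2 - alpha * f 1 * Derive_n f 2 1
            - nu * Derive_n f 3 1).
  assert (HC : forall x, 0 < x -> Ue x * Derive Ue x = C * Rpower x (2 * m - 1)).
  { intros x Hx.
    assert (Hy : 0 < Rpower x beta) by apply exp_pos.
    assert (Ht : Rpower x beta * Rpower x (- beta) = 1).
    { rewrite <- Rpower_plus, Rplus_opp_r. now apply Rpower_O. }
    generalize (Heq x (Rpower x beta) Hx Hy).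
    rewrite !(partial_derive_similarity_x psi f alpha beta Hf Hpsi),
      !(partial_derive_similarity_y psi f alpha beta Hf Hpsi)
      by (lia || assumption).
    rewrite Ht, INR_0, INR_1, (INR_IZR_INZ 2), (INR_IZR_INZ 3). simpl IZR.
    simpl (Derive_n f 0 1). intros E.
    assert (H1 : Rpower x (alpha - 1 * beta) * Rpower x (alpha - 1 * beta - 1)
                 = Rpower x (2 * m - 1)).
    { rewrite <- Rpower_plus. f_equal. lra. }
    assert (H2 : Rpower x (alpha - 0 * beta - 1) * Rpower x (alpha - 2 * beta)
                 = Rpower x (2 * m - 1)).
    { rewrite <- Rpower_plus. f_equal. lra. }
    (* Here [alpha + beta = 1] enters: it gives the viscous term the same power of [x] as the two
       quadratic terms. *)
    replace (alpha - 3 * beta) with (2 * m - 1) in E by lra.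
    apply Rplus_eq_reg_r with (nu * (Rpower x (2 * m - 1) * Derive_n f 3 1)).
    rewrite <- E.
    (* After factoring out the common power, the two products [beta * f' * f''] cancel, which leaves
       the first two terms of [C]. *)
    transitivity
      (Rpower x (2 * m - 1) * Derive_n f 1 1
         * ((alpha - 1 * beta) * Derive_n f 1 1 - beta * 1 * Derive_n f 2 1)
       - Rpower x (2 * m - 1) * Derive_n f 2 1
         * ((alpha - 0 * beta) * f 1 - beta * 1 * Derive_n f 1 1)).
    - rewrite <- H1 at 1. rewrite <- H2. ring.
    - unfold C. rewrite Hm. ring. }
  apply (nonneg_power_primitive (fun x => Ue x ^ 2) C m).
  - intros x _. apply pow2_ge_0.
  - intros x Hx. evar_last.
    { apply is_derive_pow, Derive_correct, HUe_diff, Hx. }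
    transitivity (2 * (Ue x * Derive Ue x)); [simpl; ring |].
    rewrite HC by assumption. ring.
Qed.
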